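(* Let $R\in\mathbb{N}$, let $u:B_{4R}\to\mathbb{R}$ be harmonic, where $B_{4R}\subseteq\mathbb{Z}^d$, and let $0\le\varepsilon\le0.5$. Then $$Q_u(2n)\le\sqrt{e^{n^{-2\varepsilon}}Q_u(n)Q_u(4n)}+2^{-n^{0.5-\varepsilon}}Q_u(4n)$$ for all integers $n$ with $16<n\le R$.
   Context: $\mathbb{Z}^d$ carries its standard nearest-neighbour graph structure, $|x|_1$ denotes graph distance from $0$, and $B_R=\{x\in\mathbb{Z}^d:|x|_1\le R\}$. The Laplacian is $(\Delta f)(x)=\frac{1}{2d}\sum_{y\sim x}(f(y)-f(x))$. A function $u:B_R\to\mathbb{R}$ is harmonic if $(\Delta u)(x)=0$ at every $x$ all of whose neighbours lie in $B_R$ (i.e. $|x|_1\le R-1$). $(X_n)_{n\ge0}$ is the simple random walk on $\mathbb{Z}^d$ starting at $0$, and for $u:B_R\to\mathbb{R}$ and integers $0\le n\le R$, $Q_u(n):=\mathbb{E}(u(X_n)^2)$. *)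

(* Defs.v *)
From HB Require Import structures.
From mathcomp Require Export all_boot all_order all_algebra finmap.
From mathcomp Require Export all_classical all_reals all_analysis.
Export Order.TTheory GRing.Theory Num.Theory.
Export numFieldNormedType.Exports.

Set Implicit Arguments.
Unset Strict Implicit.
Unset Printing Implicit Defensive.

Local Open Scope classical_set_scope.
Local Open Scope ring_scope.

(* Points of Z^d are integer row vectors. *)
Definition norm1 (d : nat) (x : 'rV[int]_d) : nat := (\sum_(i < d) `|x ord0 i|)%N.

(* The 2d vectors +e_i (s = (i, false)) and -e_i (s = (i, true)). *)
Definition unit_step (d : nat) (s : 'I_d * bool) : 'rV[int]_d :=
  (-1) ^+ s.2 *: delta_mx ord0 s.1.

Definition laplacian (R : realType) (d : nat) (f : 'rV[int]_d -> R)
    (x : 'rV[int]_d) : R :=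
  (d.*2)%:R^-1 * \sum_(s : 'I_d * bool) (f (x + unit_step s) - f x).

(* A function on the ball B_r is represented by a function on all of Z^d whose
   values outside B_r play no role: if norm1 x < r, then x and all of its
   neighbours lie in B_r. *)
Definition harmonic_on_ball (R : realType) (d r : nat) (u : 'rV[int]_d -> R) : Prop :=
  forall x, (norm1 x < r)%N -> laplacian u x = 0.

Section SimpleRandomWalk.
Context {disp : measure_display} {T : measurableType disp} {R : realType}.
Variables (P : probability T R) (d : nat).

(* Z^d carries the discrete sigma-algebra: measurability of x means that every
   preimage is an event. *)
Definition discrete_measurable (x : T -> 'rV[int]_d) : Prop :=
  forall A : set 'rV[int]_d, measurable (x @^-1` A).

Definition mutually_independent (xi : nat -> T -> 'rV[int]_d) : Prop :=
  forall (J : {fset nat}) (A : nat -> set 'rV[int]_d),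
    P (\bigcap_(k in [set` J]) (xi k @^-1` A k)) =
    (\prod_(k <- J) P (xi k @^-1` A k))%E.

Definition increment (X : nat -> T -> 'rV[int]_d) (k : nat) (w : T) : 'rV[int]_d :=
  X k.+1 w - X k w.

Record simple_random_walk (X : nat -> T -> 'rV[int]_d) : Prop := {
  srw_measurable : forall n, discrete_measurable (X n);
  srw_start : forall w, X 0%N w = 0;
  srw_uniform : forall k (s : 'I_d * bool),
    P (increment X k @^-1` [set unit_step s]) = ((d.*2)%:R^-1)%:E;
  srw_independent : mutually_independent (increment X)
}.

(* The expectation is finite since X n takes finitely many values almost
   surely, so fine loses no information. *)
Definition Q (X : nat -> T -> 'rV[int]_d) (u : 'rV[int]_d -> R) (n : nat) : R :=
  fine ('E_P[fun w => (u (X n w)) ^+ 2]).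

End SimpleRandomWalk.

(* Main.v *)
Require Import Defs.
From mathcomp Require Import measurable_realfun ring lra zify.

(** Let [A] be the averaging operator over the neighbours, so that [A] is the identity
    plus the Laplacian. Conditioning on the first steps of the walk gives
    [Q n = (A^n (u^2))(0)], whence Newton's formula
    [Q n = \sum_k 'C(n, k) * a_k] with [a_k] the [k]-th iterated Laplacian of [u^2] at
    [0]. For harmonic [u], the Laplacian of [u^2] is the average over the steps [s] of
    [(u(x + s) - u(x))^2], and these differences are again harmonic; hence [a_k >= 0].
    It remains to compare binomial coefficients: for [k < n^(1/2 - eps)],
    ['C(2n, k)^2 <= e^(k^2/n) 'C(n, k) 'C(4n, k)] and Cauchy-Schwarz give the square
    root, and for larger [k], ['C(2n, k) <= 2^-k 'C(4n, k)] gives the remainder. *)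

Set Implicit Arguments.
Unset Strict Implicit.
Unset Printing Implicit Defensive.

Local Open Scope classical_set_scope.
Local Open Scope ring_scope.

(** * Comparison of binomial coefficients *)

Lemma leq_double_ffact (n k : nat) : (2 ^ k * (2 * n) ^_ k <= (4 * n) ^_ k)%N.
Proof.
elim: k => [|k IHk]; first by rewrite !ffactn0.
rewrite !ffactnSr expnS.
(* Subtraction is truncated: for [k > 2 * n] the left side is 0. *)
have h : (2 * (2 * n - k) <= 4 * n - k)%N by lia.
by rewrite (_ : (_ * _ = (2 ^ k * (2 * n) ^_ k) * (2 * (2 * n - k)))%N);
  [exact: leq_mul | ring].
Qed.

Lemma leq_double_bin (n k : nat) : (2 ^ k * 'C(2 * n, k) <= 'C(4 * n, k))%N.
Proof.
by rewrite -(leq_pmul2r (fact_gt0 k)) -mulnA !bin_ffact leq_double_ffact.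
Qed.

(** The factors are compared one at a time; the exponent arises as [k ^ 2], the sum of [2 * j + 1]
    over [j < k]. *)
Lemma sqr_ffact_le (R : realType) (n k : nat) : (k.*2 <= n)%N ->
  ((2 * n) ^_ k)%:R ^+ 2 <=
    expR ((k ^ 2)%:R / n%:R) * (n ^_ k)%:R * ((4 * n) ^_ k)%:R :> R.
Proof.
elim: k => [|k IHk] kn; first by rewrite !ffactn0 mul0r expR0 !mulr1 expr1n.
have {IHk} := IHk ltac:(lia).
have -> : (k.+1 ^ 2)%:R / n%:R = (k ^ 2)%:R / n%:R + (2 * k%:R + 1) / n%:R :> R.
  by rewrite -mulrDl !natrX -natr1; congr (_ / _); ring.
move: (_ / _) => E.
rewrite !ffactnSr !natrM !natrB; [|lia..]; rewrite !natrM.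
set a := (_ ^_ _)%:R; set b := (_ ^_ _)%:R; set c := (_ ^_ _)%:R.
set N : R := n%:R; set K : R := k%:R => IHk.
have N0 : 0 < N by rewrite ltr0n; lia.
have K0 : 0 <= K by rewrite ler0n.
have KN : 2 * K <= N by rewrite -natrM ler_nat; lia.
rewrite expRD exprMn.
have h : (2 * N - K) ^+ 2 <= expR ((2 * K + 1) / N) * ((N - K) * (4 * N - K)).
  have e : 1 + K / N <= expR ((2 * K + 1) / N).
    apply: le_trans (expR_ge1Dx _); rewrite lerD2l ler_pM2r ?invr_gt0 //; lra.
  have p : 0 <= (N - K) * (4 * N - K) by apply: mulr_ge0; lra.
  apply: le_trans (ler_wpM2r p e).
  rewrite -(ler_pM2l N0).
  have -> : N * ((1 + K / N) * ((N - K) * (4 * N - K))) =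
            (N + K) * ((N - K) * (4 * N - K)) by field; lra.
  rewrite -subr_ge0.
  (* Each term in the parentheses is nonnegative because [2 * K <= N]. *)
  have -> : (N + K) * ((N - K) * (4 * N - K)) - N * (2 * N - K) ^+ 2 =
    K * (3 * N * (N - 2 * K) + N * K + K ^+ 2) by ring.
  by rewrite mulr_ge0 // !addr_ge0 ?sqr_ge0 ?mulr_ge0 //; lra.
have -> : expR E * expR ((2 * K + 1) / N) * (b * (N - K)) *
  (c * (4 * N - K)) = (expR E * b * c) *
  (expR ((2 * K + 1) / N) * ((N - K) * (4 * N - K))) by ring.
by apply: ler_pM; rewrite ?sqr_ge0.
Qed.

Lemma sqr_bin_le (R : realType) (n k : nat) : (k.*2 <= n)%N ->
  'C(2 * n, k)%:R ^+ 2 <=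
    expR ((k ^ 2)%:R / n%:R) * 'C(n, k)%:R * 'C(4 * n, k)%:R :> R.
Proof.
move=> kn; have := sqr_ffact_le R kn; move: (expR _) => e; rewrite -!bin_ffact !natrM.
have f0 : 0 < (k`!)%:R ^+ 2 :> R by rewrite exprn_gt0 // ltr0n fact_gt0.
move=> h; rewrite -(ler_pM2r f0) -exprMn; apply: le_trans h _.
by rewrite le_eqVlt; apply/orP; left; apply/eqP; ring.
Qed.

(** Cauchy-Schwarz, proved by adding one index at a time. The cross term is controlled by AM-GM: [(2
    * x i * X)^2 <= 4 * (y i * Z) * (Y * z i) <= (y i * Z + Y * z i)^2]. *)
Lemma sum_le_sqrt_mul (R : realType) (I : Type) (s : seq I) (p : pred I)
    (x y z : I -> R) :
  (forall i, p i -> [/\ 0 <= x i, 0 <= y i, 0 <= z i & x i ^+ 2 <= y i * z i]) ->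
  \sum_(i <- s | p i) x i <=
    Num.sqrt ((\sum_(i <- s | p i) y i) * (\sum_(i <- s | p i) z i)).
Proof.
move=> h.
suff [X0 Y0 Z0 XYZ] : [/\ 0 <= \sum_(i <- s | p i) x i,
    0 <= \sum_(i <- s | p i) y i, 0 <= \sum_(i <- s | p i) z i
    & (\sum_(i <- s | p i) x i) ^+ 2 <=
      (\sum_(i <- s | p i) y i) * (\sum_(i <- s | p i) z i)].
  by rewrite -[leLHS]ger0_norm // -sqrtr_sqr ler_wsqrtr.
apply: (big_rec3 (fun Z Y X => [/\ 0 <= X, 0 <= Y, 0 <= Z & X ^+ 2 <= Y * Z])).
  by split; rewrite // expr0n mul0r.
move=> i Z Y X /h [xi0 yi0 zi0 xyz] [X0 Y0 Z0 XYZ]; split; try exact: addr_ge0.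
have h2 : 2 * (x i * X) <= y i * Z + Y * z i.
  have p0 : 0 <= y i * Z + Y * z i by rewrite addr_ge0 ?mulr_ge0.
  rewrite -(@ler_pXn2r _ 2) ?nnegrE ?mulr_ge0 //.
  have := ler_pM (sqr_ge0 _) (sqr_ge0 _) xyz XYZ.
  have := sqr_ge0 (y i * Z - Y * z i); nra.
nra.
Qed.

(** The inequality with the walk abstracted away. One summation range serves all [m <= 4 * n], since
    ['C(m, k) = 0] for [k > m]. *)
Lemma three_circles_binomial (R : realType) (n : nat) (a q : nat -> R) (eps : R) :
  (16 < n)%N -> 0 <= eps -> eps <= 2^-1 ->
  (forall k, (k <= 4 * n)%N -> 0 <= a k) ->
  (forall m, (m <= 4 * n)%N -> q m = \sum_(k < (4 * n).+1) 'C(m, k)%:R * a k) ->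
  q (2 * n)%N <=
    Num.sqrt (expR (n%:R `^ (- (2 * eps))) * q n * q (4 * n)%N)
    + 2 `^ (- (n%:R `^ (2^-1 - eps))) * q (4 * n)%N.
Proof.
move=> n16 eps0 eps2 a0 qE; rewrite !qE; [|lia..].
have aO (k : 'I_(4 * n).+1) : 0 <= a k by rewrite a0 // -ltnS.
set t := n%:R `^ (2^-1 - eps); set c := expR _.
have n1 : 1 <= n%:R :> R by rewrite ler1n; lia.
have n0 : 0 < n%:R :> R by apply: lt_le_trans n1.
have t0 : 0 < t by rewrite powR_gt0.
(* Thus [k < t] gives [k^2 / n <= n^(-2 eps)], the exponent in [c]. *)
have tE : t ^+ 2 = n%:R * n%:R `^ (- (2 * eps)).
  rewrite expr2 -{1}(powRr1 (ltW n0)) -!powRD; last 2 first.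
  - by rewrite (gt_eqF n0) implybT.
  - by rewrite (gt_eqF n0) implybT.
  by congr (_ `^ _); field.
have tn : t ^+ 2 <= n%:R.
  rewrite tE -[leRHS]mulr1 ler_pM2l // -[leRHS](powRr0 n%:R) ler_powR //; lra.
rewrite (bigID (fun k : 'I__ => k%:R < t)) /=; apply: lerD.
  apply: le_trans (sum_le_sqrt_mul (y := fun k : 'I__ => c * ('C(n, k)%:R * a k))
    (z := fun k : 'I__ => 'C(4 * n, k)%:R * a k) _ _) _ => [k kt|].
    split; rewrite ?mulr_ge0 ?expR_ge0 //.
    have k2 : (k%:R : R) ^+ 2 <= t ^+ 2 by rewrite ler_pXn2r ?nnegrE // ltW.
    (* From [k^2 <= n] and [n > 16]. *)
    have kn : (k.*2 <= n)%N.
      have : (k ^ 2 <= n)%N by rewrite -(ler_nat R) natrX (le_trans k2).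
      nia.
    have e : expR ((k ^ 2)%:R / n%:R) <= c.
      by rewrite ler_expR ler_pdivrMr // natrX mulrC -tE.
    have := sqr_bin_le R kn.
    have p : 0 <= 'C(n, k)%:R * 'C(4 * n, k)%:R :> R by rewrite mulr_ge0.
    have := ler_wpM2r p e; rewrite !mulrA => h1 h2.
    have := le_trans h2 h1; have := sqr_ge0 (a k); nra.
  (* The sums over [k < t] are extended to full sums by adding nonnegative terms. *)
  apply: ler_wsqrtr; rewrite -mulr_sumr ler_pM ?mulr_ge0 ?expR_ge0 ?sumr_ge0 // => [k _|k _||].
  - by rewrite mulr_ge0.
  - by rewrite mulr_ge0.
  - rewrite ler_pM2l ?expR_gt0 // [leRHS](bigID (fun k : 'I__ => k%:R < t)) /=.
    by rewrite lerDl sumr_ge0 // => k _; rewrite mulr_ge0.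
  - rewrite [leRHS](bigID (fun k : 'I__ => k%:R < t)) /=.
    by rewrite lerDl sumr_ge0 // => k _; rewrite mulr_ge0.
rewrite mulr_sumr [leRHS](bigID (fun k : 'I__ => k%:R < t)) /= -[leLHS]add0r.
apply: lerD; first by apply: sumr_ge0 => k _; rewrite !mulr_ge0 ?powR_ge0.
apply: ler_sum => k; rewrite -leNgt => tk; rewrite mulrA ler_wpM2r //.
have : (2 ^ k * 'C(2 * n, k))%:R <= 'C(4 * n, k)%:R :> R by rewrite ler_nat leq_double_bin.
rewrite natrM natrX => h.
rewrite powRN ler_pdivlMl ?powR_gt0 //; apply: le_trans h.
by rewrite ler_wpM2r // -powR_mulrn // ler_powR // ler1n.
Qed.

(** * Averaging, iterated Laplacians and harmonic functions *)

Section AveragingOperator.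
Variables (R : realType) (d : nat).
Implicit Types (f g u : 'rV[int]_d -> R) (x : 'rV[int]_d).

Definition average f x : R :=
  (d.*2)%:R^-1 * \sum_(s : 'I_d * bool) f (x + unit_step s).

Definition step_diff (s : 'I_d * bool) f x : R := f (x + unit_step s) - f x.

Lemma averageE f x : (0 < d)%N -> average f x = f x + laplacian f x.
Proof.
move=> d0; rewrite /average /laplacian big_split /= sumrN sumr_const.
have c0 : (d.*2)%:R != 0 :> R by rewrite pnatr_eq0 double_eq0 -lt0n.
have -> : f x *+ #|{: 'I_d * bool}| = (d.*2)%:R * f x.
  by rewrite card_prod card_ord card_bool muln2 mulr_natl.
by rewrite mulrBr (mulKf c0) addrC subrK.
Qed.

Lemma norm1_unit_step x s : (norm1 (x + unit_step s) <= (norm1 x).+1)%N.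
Proof.
case: s => i b; rewrite /norm1 /unit_step /= (bigD1 i) //= [in leqRHS](bigD1 i) //= -addSn.
apply: leq_add.
  rewrite !mxE !eqxx /= mulr1n mulr1; case: b; rewrite /= ?expr1 ?expr0; lia.
by apply/leq_sum => j ji; rewrite !mxE eqxx /= (negbTE ji) mulr0 addr0.
Qed.

(** Each Laplacian looks one step further. This permits rewriting under iterated Laplacians with
    identities valid only inside a ball. *)
Lemma iter_laplacian_local k f g x :
  (forall y, (norm1 y <= norm1 x + k)%N -> f y = g y) ->
  iter k (@laplacian R d) f x = iter k (@laplacian R d) g x.
Proof.
elim: k x => [|k IHk] x fg; first by apply: fg; rewrite addn0.
rewrite !iterS {1 3}/laplacian; congr (_ * _); apply: eq_bigr => s _.
rewrite [in LHS]IHk => [|y hy]; last by apply: fg; have := norm1_unit_step x s; lia.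
by rewrite (IHk x) // => y hy; apply: fg; lia.
Qed.

Lemma laplacian_sum (I : finType) (c : R) (F : I -> 'rV[int]_d -> R) x :
  laplacian (fun y => c * \sum_i F i y) x = c * \sum_i laplacian (F i) x.
Proof.
rewrite /laplacian -mulr_sumr mulrCA; congr (_ * _); rewrite exchange_big /= [RHS]mulr_sumr.
by apply: eq_bigr => s _; rewrite -mulrBr -sumrB.
Qed.

Lemma iter_laplacian_sum (I : finType) k (c : R) (F : I -> 'rV[int]_d -> R) x :
  iter k (@laplacian R d) (fun y => c * \sum_i F i y) x =
  c * \sum_i iter k (@laplacian R d) (F i) x.
Proof.
elim: k x => [//|k IHk] x.
by rewrite iterS (funext IHk) laplacian_sum.
Qed.

(** The Laplacian commutes with translations; one unit of radius is lost because [x + unit_step s]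
    may lie one step further out. *)
Lemma harmonic_step_diff r u s :
  harmonic_on_ball r.+1 u -> harmonic_on_ball r (step_diff s u).
Proof.
move=> hu x hx.
have h1 := hu x ltac:(lia).
have h2 := hu (x + unit_step s) ltac:(by rewrite ltnS (leq_trans (norm1_unit_step x s))).
rewrite -[RHS](subrr 0) -{1}h2 -h1 /laplacian -mulrBr -sumrB; congr (_ * _).
by apply: eq_bigr => s' _; rewrite /step_diff (addrAC x); ring.
Qed.

(** Average [b^2 - a^2 = (b - a)^2 + 2 * a * (b - a)] over the neighbours. *)
Lemma laplacian_sqr u x : laplacian u x = 0 ->
  laplacian (fun y => u y ^+ 2) x = (d.*2)%:R^-1 * \sum_s step_diff s u x ^+ 2.
Proof.
move=> hu.
have -> : laplacian (fun y => u y ^+ 2) x =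
    (d.*2)%:R^-1 * \sum_s step_diff s u x ^+ 2 + 2 * u x * laplacian u x.
  rewrite /laplacian [X in _ + X]mulrCA -mulrDr; congr (_ * _).
  rewrite mulr_sumr -big_split /=.
  by apply: eq_bigr => s _; rewrite /step_diff; ring.
by rewrite hu mulr0 addr0.
Qed.

Lemma iter_laplacian_sqr_ge0 k r u x : harmonic_on_ball r u ->
  (norm1 x + k <= r)%N -> 0 <= iter k (@laplacian R d) (fun y => u y ^+ 2) x.
Proof.
elim: k r u x => [|k IHk] r u x hu hr; first by rewrite sqr_ge0.
(* The innermost Laplacian acts on the square itself and turns it into squares of differences,
   harmonic on a ball smaller by one. *)
rewrite iterSr (@iter_laplacian_local _ _
  (fun y => (d.*2)%:R^-1 * \sum_s step_diff s u y ^+ 2)); last first.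
  by move=> y hy; apply/laplacian_sqr/hu; lia.
rewrite iter_laplacian_sum mulr_ge0 ?invr_ge0 // sumr_ge0 // => s _.
case: r hu hr => [|r] hu hr; first lia.
apply: (IHk r (step_diff s u)); [exact: harmonic_step_diff | lia].
Qed.

End AveragingOperator.

(** * Newton's forward difference formula *)

Lemma newton_forward (R : realType) (q : nat -> nat -> R) (n N j : nat) :
  (forall m k, q m.+1 k = q m k + q m k.+1) -> (n < N)%N ->
  q n j = \sum_(k < N) 'C(n, k)%:R * q 0%N (j + k)%N.
Proof.
move=> qS; elim: n N j => [|n IHn] [//|N] j hN.
  by rewrite big_ord_recl big1 /= ?bin0 ?addn0 ?mul1r ?addr0 // => i _; rewrite bin0n mul0r.
(* The two expansions have lengths [N.+1] and [N], so that they align for Pascal's rule once the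
   [k = 0] term is split off. *)
rewrite qS (IHn N.+1 _ ltac:(lia)) (IHn N _ hN) !big_ord_recl !bin0 -addrA; congr (_ + _).
rewrite -big_split; apply: eq_bigr => i _ /=.
by rewrite binS natrD mulrDl /bump /= add1n addSnnS.
Qed.

Lemma iter_averageE (R : realType) (d n N : nat) (f : 'rV[int]_d -> R) x :
  (0 < d)%N -> (n < N)%N ->
  iter n (@average R d) f x = \sum_(k < N) 'C(n, k)%:R * iter k (@laplacian R d) f x.
Proof.
move=> d0 nN.
(* Averaging is the identity plus the Laplacian, so the two operators commute. *)
have avgL (g : 'rV[int]_d -> R) y : average (laplacian g) y = laplacian (average g) y.
  rewrite averageE // (funext (fun z => averageE g z d0)).
  rewrite {1 2 4}/laplacian -mulrDr -big_split /=.
  by congr (_ * _); apply: eq_bigr => s _; ring.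
have itL m g : iter m (@average R d) (laplacian g) = laplacian (iter m (@average R d) g).
  by elim: m => //= m ->; apply/funext => y; rewrite avgL.
pose q m k := iter m (@average R d) (iter k (@laplacian R d) f) x.
rewrite -[LHS]/(q n 0%N) (newton_forward _ _ nN) //.
by move=> m k; rewrite /q !iterS averageE // itL.
Qed.

(** * Law of the walk through cylinder events *)

Lemma unit_step_inj d : injective (@unit_step d).
Proof.
move=> [i b] [j c] /rowP e.
have := e i; have := e j; rewrite !mxE !eqxx /=.
by case: (eqVneq j i) => [->|_]; case: b {e}; case: c.
Qed.

Section WalkExpectation.
Context {disp : measure_display} {T : measurableType disp} {R : realType}.
Variables (P : probability T R) (d : nat) (X : nat -> T -> 'rV[int]_d).
Hypotheses (d_gt0 : (0 < d)%N) (srwX : simple_random_walk P X).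

(** Increments are prescribed rather than positions, to match the independence assumption. *)
Definition cylinder (s : seq ('I_d * bool)) : set T :=
  [set w | forall k, (k < size s)%N -> increment X k w = nth 0 (map (@unit_step d) s) k].

Lemma cylinder_rcons s a :
  cylinder (rcons s a) = cylinder s `&` increment X (size s) @^-1` [set unit_step a].
Proof.
apply/seteqP; split=> w /=; rewrite /cylinder /= size_rcons map_rcons.
- move=> h; split=> [k ks|].
  + by rewrite h ?ltnS ?(ltnW ks) // nth_rcons size_map ks.
  + by rewrite h // nth_rcons size_map ltnn eqxx.
- move=> [h1 h2] k; rewrite ltnS leq_eqVlt nth_rcons size_map.
  by case: (ltngtP k (size s)) => //= [ks _|->//]; exact: h1.
Qed.

Lemma walk_on_cylinder s w : cylinder s w -> X (size s) w = \sum_(a <- s) unit_step a.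
Proof.
elim/last_ind: s => [_|s a IHs]; first by rewrite big_nil (srw_start srwX).
rewrite cylinder_rcons => -[/IHs XE /= inc].
by rewrite size_rcons -cats1 big_cat big_seq1 -XE -inc /increment [RHS]addrC subrK.
Qed.

Lemma measurable_increment k (v : 'rV[int]_d) : measurable (increment X k @^-1` [set v]).
Proof.
(* Splitting over the countably many values of [X k] reduces to events of [X k] and [X k.+1]
   separately. *)
have -> : increment X k @^-1` [set v] =
    \bigcup_z (X k @^-1` [set z] `&` X k.+1 @^-1` [set v + z]).
  apply/seteqP; split=> w; rewrite /increment /=.
    by move=> <-; exists (X k w) => //=; rewrite subrK.
  by move=> [z _ /= [-> ->]]; rewrite addrK.
apply: countable_bigcupT_measurable => [|z]; first exact: countableP.
by apply: measurableI; apply: (srw_measurable srwX).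
Qed.

Lemma measurable_cylinder s : measurable (cylinder s).
Proof.
elim/last_ind: s => [|s a IHs]; last first.
  by rewrite cylinder_rcons; apply: measurableI => //; exact: measurable_increment.
by rewrite (_ : cylinder [::] = setT) //; apply/seteqP; split.
Qed.

Lemma cylinder_prob s : P (cylinder s) = ((d.*2)%:R^-1 ^+ size s)%:E.
Proof.
pose v := map (@unit_step d) s.
have -> : cylinder s =
    \bigcap_(k in [set` [fset k in iota 0 (size s)]%fset])
      (increment X k @^-1` [set nth 0 v k]).
  apply/seteqP; split=> w h k.
    by rewrite /= inE mem_iota => ks; exact: h.
  by move=> ks; apply: h; rewrite /= inE mem_iota.
rewrite (srw_independent srwX) big_seq.
transitivity (\prod_(k <- [fset k in iota 0 (size s)]%fset) ((d.*2)%:R^-1)%:E : \bar R)%E.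
  rewrite [RHS]big_seq; apply: eq_bigr => k; rewrite inE mem_iota => /andP[_ ks].
  (* Only a default element for [nth_map]. *)
  have [a _] : exists a : 'I_d * bool, True by exists (Ordinal d_gt0, true).
  by rewrite (nth_map a) // (srw_uniform srwX).
rewrite prodEFin; congr EFin.
by rewrite big_const_seq count_predT card_fseq undup_id ?iota_uniq // size_iota iter_mulr_1.
Qed.

Lemma trivIset_cylinder_rcons s : trivIset setT (fun a => cylinder (rcons s a)).
Proof.
move=> a b _ _ [w]; rewrite !cylinder_rcons => -[[_ /= ha] [_ hb]].
by apply: unit_step_inj; rewrite -ha.
Qed.

Lemma measurable_walk_fun n (f : 'rV[int]_d -> R) (D : set T) :
  measurable_fun D (EFin \o (fun w => f (X n w))).
Proof.
apply: measurable_funTS => _ Y _; rewrite setTI.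
exact: (srw_measurable srwX n (fun x => Y (f x)%:E)).
Qed.

(** The one-step extensions are disjoint, and their [2d] equal probabilities add up to that of the
    cylinder, so what they leave uncovered is a null set. *)
Lemma integral_cylinder_rcons s (f : T -> \bar R) :
  measurable_fun setT f -> (forall w, 0 <= f w)%E ->
  (\int[P]_(w in cylinder s) f w =
   \sum_(a : 'I_d * bool) \int[P]_(w in cylinder (rcons s a)) f w)%E.
Proof.
pose U := \big[setU/set0]_(a : 'I_d * bool) cylinder (rcons s a).
have mU : measurable U by apply: bigsetU_measurable => a _; exact: measurable_cylinder.
have intU g : measurable_fun setT g -> (forall w, 0 <= g w)%E ->
    (\int[P]_(w in U) g w = \sum_(a : 'I_d * bool) \int[P]_(w in cylinder (rcons s a)) g w)%E.
  move=> mg g0; apply: ge0_integral_bigsetU => //.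
  - by move=> a; exact: measurable_cylinder.
  - exact: index_enum_uniq.
  - by apply: sub_trivIset (@trivIset_cylinder_rcons s).
  - exact: measurable_funTS.
move=> mf f0; rewrite -intU //.
(* The probability of [U] is the integral of 1, so [intU] applies to it as well. *)
have PU : P U = P (cylinder s).
  rewrite -[LHS]mul1e -integral_cst // intU //.
  transitivity (\sum_(a : 'I_d * bool) ((d.*2)%:R^-1 ^+ (size s).+1)%:E : \bar R)%E.
    apply: eq_bigr => a _; rewrite integral_cst; last exact: measurable_cylinder.
    by rewrite mul1e -(size_rcons s a); exact: cylinder_prob.
  rewrite cylinder_prob sumEFin sumr_const card_prod card_ord card_bool muln2; congr EFin.
  by rewrite exprSr -(mulr_natr (_ * _)) -mulrA mulVf ?mulr1 // pnatr_eq0 double_eq0 -lt0n.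
have US : U `<=` cylinder s.
  by rewrite /U -bigcup_seq => w [a _]; rewrite cylinder_rcons => -[].
have mS := measurable_cylinder s.
rewrite (@ge0_negligible_integral _ _ _ P _ (cylinder s `\` U)) //.
- by rewrite setDD (setIidr US).
- exact: measurableD.
- exact: measurable_funTS.
- have fP : (P (cylinder s) < +oo)%E by rewrite cylinder_prob ltry.
  have PD : (P (cylinder s) - P U = 0)%E by rewrite PU subee // cylinder_prob.
  by rewrite [LHS]measureD // (setIidr US).
Qed.

(** The Markov property, by induction on the remaining steps [m]: splitting on the next step
    lengthens [s] and applies one more average. *)
Lemma integral_walk_cylinder (f : 'rV[int]_d -> R) m s : (forall x, 0 <= f x) ->
  (\int[P]_(w in cylinder s) (f (X (size s + m)%N w))%:E =
   ((d.*2)%:R^-1 ^+ size s * iter m (@average R d) f (\sum_(a <- s) unit_step a))%:E)%E.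
Proof.
move=> f0; elim: m s => [|m IHm] s.
  under eq_integral => w /set_mem hw do rewrite addn0 (walk_on_cylinder hw).
  rewrite integral_cst; last exact: measurable_cylinder.
  by rewrite mulrC EFinM; congr (_ * _)%E; exact: cylinder_prob.
rewrite integral_cylinder_rcons; [|exact: measurable_walk_fun|by move=> w; rewrite lee_fin].
under eq_bigr => a _.
  rewrite -addSnnS -(size_rcons s a) IHm size_rcons -cats1 big_cat big_seq1 /=.
  over.
by rewrite sumEFin iterS /average -mulr_sumr exprSr mulrA.
Qed.

Lemma Q_eq_iter_average (u : 'rV[int]_d -> R) n :
  Q P X u n = iter n (@average R d) (fun x => u x ^+ 2) 0.
Proof.
rewrite /Q unlock.
have := @integral_walk_cylinder (fun x => u x ^+ 2) n [::] (fun x => sqr_ge0 _).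
rewrite big_nil mul1r (_ : cylinder [::] = setT) => [->//|].
by apply/seteqP; split.
Qed.

End WalkExpectation.

Theorem theorem1p11 (R : realType) (d : nat) (d_gt0 : (0 < d)%N)
    (disp : measure_display) (T : measurableType disp) (P : probability T R)
    (X : nat -> T -> 'rV[int]_d) (srwX : simple_random_walk P X)
    (r : nat) (u : 'rV[int]_d -> R) (harm_u : harmonic_on_ball (4 * r)%N u)
    (eps : R) (eps_ge0 : 0 <= eps) (eps_le : eps <= 2^-1)
    (n : nat) (n_gt16 : (16 < n)%N) (n_le : (n <= r)%N) :
  Q P X u (2 * n)%N <=
    Num.sqrt (expR (n%:R `^ (- (2 * eps))) * Q P X u n * Q P X u (4 * n)%N)
    + 2 `^ (- (n%:R `^ (2^-1 - eps))) * Q P X u (4 * n)%N.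
Proof.
apply: (three_circles_binomial
  (a := fun k => iter k (@laplacian R d) (fun x => u x ^+ 2) 0)) => // k kn.
(* The origin has norm 0, and [k <= 4 * n <= 4 * r] fits in the radius. *)
- apply: iter_laplacian_sqr_ge0 harm_u _.
  by rewrite /norm1 big1 => [|i _]; [lia | rewrite mxE].
- by rewrite (Q_eq_iter_average d_gt0 srwX) (@iter_averageE _ _ _ (4 * n).+1).
Qed.
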